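(* Let $G$ be a honeycomb, 4.8.8 or 4.6.12 lattice on a torus, large enough that every non-contractible cycle has length greater than $8$. Let $u$ be any vertex of $G$. Choose a defect edge $e=\{u,w\}$ at $u$ as follows: for the honeycomb lattice, any edge at $u$; for the 4.8.8 lattice, an edge at $u$ bordering a square and an octagon; for the 4.6.12 lattice, an edge at $u$ bordering a square and a hexagon. Let $G'$ be the output of the super-plaquette algorithm applied to $(G,e)$. Then $G'$ uses only connections of $G$, and $L(G')$ equals $7$ for the honeycomb lattice, $7$ for the 4.8.8 lattice and $6$ for the 4.6.12 lattice. Moreover, $L(G')\le L(H)$ for every lattice $H$ satisfying all of the following: - $H$ is a tri-valent, 3-face-colourable multigraph embedded on the same torus; - its vertex set is $V(G)\setminus\{u,w'\}$ for some neighbour $w'$ of $u$; - every edge of $H$ joins two vertices adjacent in $G$.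
   Context: A colour-code lattice is a finite multigraph, in which parallel edges are allowed but loops are not, cellularly embedded in a closed surface. It must be tri-valent, meaning every vertex has degree 3. It must also be 3-face-colourable: each face carries one of three colours (red, green, blue) such that any two faces sharing an edge have different colours. Every edge lies on the boundary of two faces of different colours and is assigned the third colour. A face is identified with its set of boundary edges. The super-plaquette algorithm takes as input a colour-code lattice $G$, a vertex $u$ and an edge $e=\{u,w\}$ of colour $D$. It proceeds as follows. 1. Let $S_1,S_2$ be the two faces containing $e$; these are the shrink faces. 2. Let the merge faces be all faces of colour $D$ that share an edge with $S_1$ or $S_2$. 3. For each shrink face $S$, of colour $P$, and each edge $f$ of colour $D$ on the boundary of $S$ that contains neither $u$ nor $w$, add a new edge $f'$ joining the same endpoints as $f$. Give $f'$ the colour $T\notin\{D,P\}$, and add a new face $\{f,f'\}$ of colour $P$. 4. Delete the shrink faces. 5. Add a new face of colour $D$ consisting of all new edges $f'$, together with all edges of merge faces that are not on a shrink face. 6. Delete the merge faces. 7. Delete $u$, $w$ and all edges lying on no face. The honeycomb, 4.8.8 and 4.6.12 lattices are the periodic (torus) versions of the uniform planar tilings by regular polygons with vertex configurations 6.6.6, 4.8.8 and 4.6.12, respectively. Each is tri-valent and 3-face-colourable. For a multigraph $H$ with $V(H)\subseteq V(G)$, define $L(H)$ as the number of unordered pairs $\{x,y\}$ of vertices that are adjacent in $G$ but are not adjacent in $H$. Pairs involving a vertex not in $H$ also count. This quantity is the number of removed connections. *)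

(* Defs.v *)
(* Colour-code lattices as combinatorial maps (rotation
   systems) with vertex labels in a fixed finite type V. *)
From mathcomp Require Import all_boot.
Set Implicit Arguments. Unset Strict Implicit. Unset Printing Implicit Defensive.

(* Combinatorial maps.  Darts D, edge involution alpha, vertex rotation
   sigma, vertex labelling vert.  Faces are the orbits of phi = sigma o alpha;
   the dart d lies on the face (corner) at vert d, the edge {d, alpha d}
   borders the faces of d and of alpha d.                               *)
Section Maps.
Variables (V D : finType) (alpha sigma : D -> D) (vert : D -> V).

Definition phi (d : D) : D := sigma (alpha d).

Definition edg (d : D) : {set D} := [set d; alpha d].

(* cellular embedding of a loopless connected multigraph in the torus:
   orientable (rotation system) with Euler characteristic V - E + F = 0 *)
Definition is_torus_map : Prop :=
  injective sigma /\
  (forall d, alpha (alpha d) = d) /\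
  (forall d, alpha d != d) /\
  (forall d d', (vert d == vert d') = fconnect sigma d d') /\
  (forall d, vert (alpha d) != vert d) /\
  (forall d d', connect (fun x y => (y == alpha x) || (y == sigma x)) d d') /\
  2 * (fcard sigma D + fcard phi D) = #|D|.

Definition trivalent : Prop := forall d, order sigma d = 3.

Definition face_colouring (col : D -> 'I_3) : Prop :=
  (forall d, col (phi d) = col d) /\ (forall d, col d != col (alpha d)).

Definition colour_code_lattice (col : D -> 'I_3) : Prop :=
  is_torus_map /\ trivalent /\ face_colouring col.

Definition three_face_colourable : Prop := exists col, face_colouring col.

Definition map_vertices : {set V} := vert @: [set: D].

Definition map_adj (x y : V) : bool :=
  [exists d, (vert d == x) && (vert (alpha d) == y)].

Definition graph_cycle (p : seq D) : bool :=
  [&& p != [::], cycle (fun x y => vert (alpha x) == vert y) p,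
      uniq (map vert p) & uniq (map edg p)].

(* a cycle is contractible iff its edge set is the (mod 2) boundary of a
   set of faces *)
Definition contractible (p : seq D) : Prop :=
  exists Fs : {set D},
    (forall x, (phi x \in Fs) = (x \in Fs)) /\
    (forall x, ((x \in Fs) != (alpha x \in Fs)) = ((x \in p) || (alpha x \in p))).

End Maps.

Definition third (a b : 'I_3) : 'I_3 := odflt a [pick c : 'I_3 | (c != a) && (c != b)].

Definition removed_connections (V : finType) (adjG adjH : V -> V -> bool) : nat :=
  #|[set s : {set V} | [exists x, exists y,
       [&& s == [set x; y], adjG x y & ~~ adjH x y]]]|.

(* The super-plaquette algorithm, in the face-as-edge-set representation.
   Edges are of type {set D} * bool : (edg d, false) is the original edge of
   G carried by d, (edg d, true) is the new parallel copy f' of it.       *)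
Section SuperPlaquette.
Variables (V D : finType) (alpha sigma : D -> D) (vert : D -> V)
          (col : D -> 'I_3) (d0 : D).

Definition sp_edge := ({set D} * bool)%type.

Definition oe (d : D) : sp_edge := (edg alpha d, false).
Definition copy (f : sp_edge) : sp_edge := (f.1, true).
Definition ends (f : sp_edge) : {set V} := vert @: f.1.

Definition ecol0 (f : sp_edge) : 'I_3 :=
  if [pick y in f.1] is Some y then third (col y) (col (alpha y)) else ord0.

Definition EG : {set sp_edge} := [set oe d | d : D].
Definition face_of (d : D) : {set sp_edge} :=
  oe @: [set x | fconnect (phi alpha sigma) d x].
Definition FG : {set {set sp_edge}} := [set face_of d | d : D].
Definition fcolG (F : {set sp_edge}) : 'I_3 :=
  if [pick d | face_of d == F] is Some d then col d else ord0.

Definition sp_e := oe d0.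
Definition sp_u := vert d0.
Definition sp_w := vert (alpha d0).
Definition sp_D := ecol0 sp_e.

Definition shrink : {set {set sp_edge}} := [set F in FG | sp_e \in F].
Definition merge : {set {set sp_edge}} :=
  [set F in FG | (fcolG F == sp_D) && [exists S in shrink, [exists x in F, x \in S]]].
Definition doubled : {set sp_edge} :=
  [set f in EG | [&& [exists S in shrink, f \in S], ecol0 f == sp_D,
                     sp_u \notin ends f & sp_w \notin ends f]].
Definition new_edges : {set sp_edge} := copy @: doubled.
Definition pair_faces : {set {set sp_edge}} := [set [set f; copy f] | f in doubled].
Definition big_face : {set sp_edge} :=
  new_edges :|: [set x in \bigcup_(M in merge) M | [forall S in shrink, x \notin S]].
Definition faces' : {set {set sp_edge}} :=
  ((((FG :|: pair_faces) :\: shrink) :|: [set big_face]) :\: merge).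
Definition verts' : {set V} := map_vertices vert :\ sp_u :\ sp_w.
Definition edges' : {set sp_edge} :=
  [set x in EG :|: new_edges |
     [&& [exists F in faces', x \in F], sp_u \notin ends x & sp_w \notin ends x]].

Definition adj' (x y : V) : bool := [exists f in edges', ends f == [set x; y]].

End SuperPlaquette.

(* The three lattice families, characterised combinatorially by their
   vertex configurations (face lengths around each vertex).            *)
Inductive lattice_kind := Honeycomb | L488 | L4612.

Definition kind_ok (k : lattice_kind) (D : finType) (alpha sigma : D -> D) : Prop :=
  let len d := order (phi alpha sigma) d in
  match k with
  | Honeycomb => forall d, len d = 6
  | L488 => forall d, perm_eq [:: len d; len (sigma d); len (sigma (sigma d))] [:: 4; 8; 8]
  | L4612 => forall d, perm_eq [:: len d; len (sigma d); len (sigma (sigma d))] [:: 4; 6; 12]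
  end.

Definition defect_ok (k : lattice_kind) (D : finType) (alpha sigma : D -> D) (d0 : D) : Prop :=
  let len d := order (phi alpha sigma) d in
  match k with
  | Honeycomb => True
  | L488 => perm_eq [:: len d0; len (alpha d0)] [:: 4; 8]
  | L4612 => perm_eq [:: len d0; len (alpha d0)] [:: 4; 6]
  end.

Definition expected_L (k : lattice_kind) : nat :=
  match k with Honeycomb => 7 | L488 => 7 | L4612 => 6 end.

(* Main.v *)
Require Import Defs.
From mathcomp Require Import all_boot.
From mathcomp Require Import zify.
Set Implicit Arguments. Unset Strict Implicit. Unset Printing Implicit Defensive.

(* The lattice is bipartite and has no parallel edges.  A simple cycle is a word
   of left and right turns, and the turns determine the colours of the faces on
   its two sides.  If the cycle bounds a set of faces, then for each colour c
   the number of corners of colour c in this set is a multiple of the length of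
   the c-faces; the vertices off the cycle contribute equally to all colours,
   so the counts on the cycle are congruent modulo the gcds of the face lengths.
   An enumeration of words shows that every 4-cycle is a face and that in 4.8.8
   no 6-cycle passes along a square through the two outer edges.

   The algorithm removes the defect edge and every second edge of each shrink
   face, (l1 + l2) / 2 + 1 connections for shrink faces of lengths l1 and l2.

   For a competing lattice H, five removed connections touch u or w'.  Each of
   their four other neighbours has only two possible partners in H, hence one
   double edge of H; unless this double edge leads to another of the four, its
   far end loses a further connection, and such a loss serves at most two ends.
   Double edges among the four close 4-cycles, a loss serving two ends closes a
   6-cycle, and the facts on short cycles give the bound. *)

(** * Third colours and duplicate-free lists *)

Lemma third_eq (a b c : 'I_3) : a != b -> (third a b == c) = (c != a) && (c != b).
Proof.
rewrite /third => ab; case: pickP => [e /andP[ea eb]|no] /=.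
  apply/eqP/andP => [<-//|[ca cb]]; apply/val_inj => /=.
  by move: ab ea eb ca cb; rewrite -!val_eqE /=; case: a b c e => [a ?] [b ?] [c ?] [e ?] /=; lia.
(* The colours 0, 1, 2 add up to 3, so [3 - a - b] is the third colour and [pick] cannot fail. *)
have lt : 3 - a - b < 3 by move: ab; rewrite -val_eqE /=; lia.
have := no (inord (3 - a - b)); rewrite -!val_eqE /= inordK //.
by move: ab; rewrite -val_eqE /=; case: a b {no lt} => [a ?] [b ?] /=; lia.
Qed.

Lemma uniq_map_inj (T U : eqType) (g : T -> U) (s : seq T) :
  uniq (map g s) -> {in s &, injective g}.
Proof.
move=> us x y xs ys gxy; rewrite -(nth_index x xs) -(nth_index x ys); congr nth.
apply/eqP; rewrite -(nth_uniq (g x) _ _ us) ?size_map ?index_mem //.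
by rewrite !(nth_map x) ?index_mem // !nth_index // gxy.
Qed.

(** * Darts, corners and colours at a trivalent vertex *)

Section Lattice.
Variables (V D : finType) (alpha sigma : D -> D) (vert : D -> V) (col : D -> 'I_3).
Hypothesis lattice : colour_code_lattice alpha sigma vert col.

Notation phi := (phi alpha sigma).
Notation adj := (map_adj alpha vert).
Notation len := (order phi).

Definition colour (d : D) : nat := col d.

Lemma sigma_inj : injective sigma. Proof. by case: lattice => [[]]. Qed.
Lemma alphaK : involutive alpha. Proof. by case: lattice => [[_ []]]. Qed.
Lemma alpha_neq d : alpha d != d. Proof. by case: lattice => [[_ [_ []]]]. Qed.
Lemma vert_fconnect d d' : (vert d == vert d') = fconnect sigma d d'.
Proof. by case: lattice => [[_ [_ [_ []]]]]. Qed.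
Lemma vert_alpha d : vert (alpha d) != vert d.
Proof. by case: lattice => [[_ [_ [_ [_ []]]]]]. Qed.
Lemma dart_connect d d' : connect (fun x y => (y == alpha x) || (y == sigma x)) d d'.
Proof. by case: lattice => [[_ [_ [_ [_ [_ []]]]]]]. Qed.
Lemma order_sigma d : order sigma d = 3. Proof. by case: lattice => [_ []]. Qed.
Lemma colour_phi d : colour (phi d) = colour d.
Proof. by rewrite /colour; case: lattice => [_ [_ [-> _]]]. Qed.
Lemma colour_alpha d : colour (alpha d) != colour d.
Proof. by case: lattice => [_ [_ [_ h]]]; rewrite eq_sym; apply: h. Qed.
Lemma colour_lt3 d : colour d < 3. Proof. exact: ltn_ord. Qed.

Lemma alpha_inj : injective alpha. Proof. exact: can_inj alphaK. Qed.
Lemma phi_inj : injective phi. Proof. by move=> x y /sigma_inj /alpha_inj. Qed.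
Lemma phi_alpha d : phi (alpha d) = sigma d. Proof. by rewrite /Defs.phi alphaK. Qed.
Lemma sigma3 d : sigma (sigma (sigma d)) = d.
Proof. by have := iter_order sigma_inj d; rewrite order_sigma. Qed.
Lemma vert_eq d d' : (vert d == vert d') = (d' \in [:: d; sigma d; sigma (sigma d)]).
Proof. by rewrite vert_fconnect fconnect_orbit /orbit order_sigma. Qed.
Lemma vert_sigma d : vert (sigma d) = vert d.
Proof. by apply/esym/eqP; rewrite vert_eq !inE eqxx orbT. Qed.
Lemma vert_phi d : vert (phi d) = vert (alpha d). Proof. exact: vert_sigma. Qed.
Lemma sigma_neq d : sigma d != d.
Proof.
have := orbit_uniq sigma d.
by rewrite /orbit order_sigma /= !inE negb_or eq_sym => /andP[/andP[]].
Qed.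
Lemma colour_sigma d : colour (sigma d) = colour (alpha d).
Proof. by rewrite -phi_alpha colour_phi. Qed.
Lemma colour_sigma_neq d : colour (sigma d) != colour d.
Proof. by rewrite colour_sigma colour_alpha. Qed.
Lemma colour_sigma2 d : colour (sigma (sigma d)) = 3 - colour d - colour (sigma d).
Proof.
have := colour_sigma_neq (sigma (sigma d)); rewrite sigma3.
have := colour_sigma_neq (sigma d); have := colour_sigma_neq d.
have := colour_lt3 d; have := colour_lt3 (sigma d); have := colour_lt3 (sigma (sigma d)); lia.
Qed.
(** Along one face, the faces across successive edges alternate between the other two colours. *)
Lemma colour_alpha_phi d : colour (alpha (phi d)) = 3 - colour d - colour (alpha d).
Proof.
rewrite -[LHS]colour_phi phi_alpha {1}/Defs.phi colour_sigma2.
rewrite -/(phi d) colour_phi; lia.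
Qed.
Lemma len_phi d : len (phi d) = len d.
Proof. by apply: eq_card => y; rewrite !inE -(same_fconnect1 phi_inj). Qed.
Lemma len_sigma d : len (sigma d) = len (alpha d).
Proof. by rewrite -phi_alpha len_phi. Qed.

(** * Bipartiteness *)

(* Crossing an edge reverses the cyclic order of the colours around a vertex, so
   the lattice is bipartite. *)
Definition chirality (d : D) : bool := colour (sigma d) == (colour d).+1 %% 3.

Lemma chirality_sigma d : chirality (sigma d) = chirality d.
Proof.
rewrite /chirality colour_sigma2; have := colour_sigma_neq d.
by have := colour_lt3 d; have := colour_lt3 (sigma d); lia.
Qed.

Lemma chirality_alpha d : chirality (alpha d) = ~~ chirality d.
Proof.
rewrite /chirality -/(phi d) colour_phi colour_sigma; have := colour_alpha d.
have := colour_lt3 d; have := colour_lt3 (alpha d); lia.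
Qed.

Definition side (v : V) : bool := [exists d, (vert d == v) && chirality d].

Lemma side_vert d : side (vert d) = chirality d.
Proof.
apply/existsP/idP => [[d' /andP[]]|h]; last by exists d; rewrite eqxx.
rewrite eq_sym vert_eq !inE => /or3P[] /eqP -> //; by rewrite !chirality_sigma.
Qed.

Lemma side_adj x y : adj x y -> side y = ~~ side x.
Proof. by case/existsP=> d /andP[/eqP <- /eqP <-]; rewrite !side_vert chirality_alpha. Qed.

Lemma adj_sym x y : adj x y = adj y x.
Proof.
by apply/existsP/existsP => -[d /andP[h1 h2]]; exists (alpha d); rewrite alphaK h1 h2.
Qed.

Lemma adj_dart d : adj (vert d) (vert (alpha d)).
Proof. by apply/existsP; exists d; rewrite !eqxx. Qed.

Lemma adj_irr x : adj x x = false.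
Proof. by apply/negbTE/negP => h; have := side_adj h; case: side. Qed.

(** * Walks *)

(* [true] is a left turn, which stays on the face of [d]; [false] is a right
   turn, which stays on the face of [alpha d]. *)
Definition step (t : bool) (d : D) : D := if t then phi d else sigma (sigma (alpha d)).

Lemma vert_step t d : vert (step t d) = vert (alpha d).
Proof. by case: t; rewrite /= ?vert_phi // !vert_sigma. Qed.

Lemma step_inj t : injective (step t).
Proof. by case: t => x y /=; [apply: phi_inj|move/sigma_inj/sigma_inj/alpha_inj]. Qed.

Lemma step_neq t d : step t d != alpha d.
Proof.
case: t => /=; first exact: sigma_neq.
by rewrite -{2}(sigma3 (alpha d)) eq_sym sigma_neq.
Qed.

Lemma phi_alpha_step d : phi (alpha (step false d)) = alpha d.
Proof. by rewrite phi_alpha /= sigma3. Qed.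

(** Trivalence leaves two darts at the far end besides the reverse of [d]. This is what lets a
    simple cycle be read as a word of turns. *)
Lemma step_onto d e : vert e = vert (alpha d) -> e != alpha d -> exists t, step t d = e.
Proof.
move/esym/eqP; rewrite vert_eq !inE => /or3P[/eqP ->|/eqP ->|/eqP ->]; first by rewrite eqxx.
  by exists true.
by exists false.
Qed.

Lemma step_adj d y : adj (vert (alpha d)) y -> y != vert d ->
  exists t, vert (alpha (step t d)) = y.
Proof.
case/existsP=> e /andP[/eqP e1 /eqP e2] yd.
have [|t te] := step_onto e1; last by exists t; rewrite te.
by apply: contraNneq yd => ed; rewrite -e2 ed alphaK.
Qed.

(** A state holds the colours to the left and right of a dart. The face turned towards stays
    alongside; on the other side the third colour appears. *)
Definition turn (t : bool) (s : nat * nat) : nat * nat :=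
  if t then (s.1, 3 - s.1 - s.2) else (3 - s.1 - s.2, s.2).

Definition state (d : D) : nat * nat := (colour d, colour (alpha d)).

Lemma state_step t d : state (step t d) = turn t (state d).
Proof.
case: t; rewrite /state /turn /=; first by rewrite colour_phi colour_alpha_phi.
rewrite colour_sigma2 -[in X in (_, X)]colour_phi (phi_alpha_step d).
by congr (_, _); rewrite -/(phi d) colour_phi; lia.
Qed.

Definition states : seq (nat * nat) :=
  [seq s <- [seq (a, b) | a <- iota 0 3, b <- iota 0 3] | s.1 != s.2].

Lemma state_mem d : state d \in states.
Proof.
have := colour_alpha d; have := colour_lt3 d; have := colour_lt3 (alpha d); rewrite /state.
by case: (colour d) (colour (alpha d)) => [|[|[|a]]] [|[|[|b]]].
Qed.

(** The starting dart is left out; a nonempty closed walk contains it as its last dart. *)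
Fixpoint walk (d : D) (w : seq bool) : seq D :=
  if w is t :: w' then step t d :: walk (step t d) w' else [::].

Definition walk_end (d : D) (w : seq bool) : D := foldl (fun e t => step t e) d w.

Lemma state_walk_end d w : state (walk_end d w) = foldl (fun s t => turn t s) (state d) w.
Proof. by elim: w d => //= t w IHw d; rewrite -state_step -IHw. Qed.

Lemma order_le_iter n d : 0 < n -> iter n phi d = d -> len d <= n.
Proof.
move=> n0 h; case: (leqP (len d) n) => // lt.
by have := findex_iter lt; rewrite h findex0 => e; move: n0; rewrite -e.
Qed.

Lemma walk_end_left d n : walk_end d (nseq n true) = iter n phi d.
Proof. by elim: n d => //= n IHn d; rewrite -iterS iterSr -IHn. Qed.

Lemma walk_end_right d n : iter n phi (alpha (walk_end d (nseq n false))) = alpha d.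
Proof.
elim: n d => //= n IHn d.
by rewrite -/(walk_end _ _) IHn (phi_alpha_step d).
Qed.

Definition side_face (t : bool) (d : D) : D := if t then d else alpha d.

(** Constant left turns follow [phi] round the left face, constant right turns run against [phi]
    round the right face. *)
Lemma constant_walk_len n t d : 0 < n -> walk_end d (nseq n t) = d -> len (side_face t d) <= n.
Proof.
move=> n0; case: t => /=; first by rewrite walk_end_left; apply: order_le_iter.
by move=> h; apply: order_le_iter => //; rewrite -[in LHS]h walk_end_right.
Qed.


(** * Face lengths *)

(** The three corners at a vertex have three different colours, so for [c < 3] the last branch needs
    no test. *)
Definition corner (c : nat) (d : D) : D :=
  if colour d == c then d else if colour (sigma d) == c then sigma d else sigma (sigma d).

Lemma vert_corner c d : vert (corner c d) = vert d.
Proof. by rewrite /corner; case: ifP => // _; case: ifP; rewrite ?vert_sigma. Qed.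

Lemma colour_corner c d : c < 3 -> colour (corner c d) = c.
Proof.
rewrite /corner => c3; case: ifP => [/eqP //|n1]; case: ifP => [/eqP //|n2].
rewrite colour_sigma2; have := colour_lt3 d; have := colour_lt3 (sigma d).
have := colour_sigma_neq d; lia.
Qed.

Lemma corner_eq x y : vert x = vert y -> colour x = colour y -> x = y.
Proof.
move/eqP; rewrite vert_eq !inE => /or3P[] /eqP -> //.
  by move/esym/eqP; rewrite (negbTE (colour_sigma_neq x)).
by move/eqP; rewrite -{1}(sigma3 x) (negbTE (colour_sigma_neq _)).
Qed.

Lemma corner_colour x : corner (colour x) x = x.
Proof. by rewrite /corner eqxx. Qed.

Lemma corner_vert c x y : c < 3 -> vert x = vert y -> corner c x = corner c y.
Proof. by move=> c3 xy; apply: corner_eq; rewrite ?vert_corner ?colour_corner. Qed.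

Section Lengths.
Variable ks : seq nat.
Hypothesis kind : forall d, perm_eq [:: len d; len (sigma d); len (sigma (sigma d))] ks.

(** Both ends of an edge lie on the two faces bordering it, which settles two colours. The third
    length follows because the lengths at either end have the same sum. *)
Lemma len_corner_alpha c d : c < 3 -> len (corner c (alpha d)) = len (corner c d).
Proof.
move=> c3; case: (eqVneq c (colour d)) => [->|n1].
  rewrite corner_colour -(len_phi d); congr order; apply: corner_eq.
    by rewrite vert_corner vert_phi.
  by rewrite colour_corner ?colour_lt3 // colour_phi.
case: (eqVneq c (colour (alpha d))) => [->|n2].
  rewrite corner_colour -(len_sigma d); congr order; apply/esym/corner_eq.
    by rewrite vert_corner vert_sigma.
  by rewrite colour_corner ?colour_lt3 // colour_sigma.
rewrite /corner -/(phi d) colour_phi colour_sigma.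
rewrite [colour d == c]eq_sym [colour (alpha d) == c]eq_sym (negbTE n1) (negbTE n2).
have := kind d; rewrite -(permPr (kind (alpha d))) => /perm_sumn /=; rewrite -/(phi d) len_phi len_sigma; lia.
Qed.

(** The map is connected, and neither [sigma] nor [alpha] changes the length found at the corner of
    a given colour. *)
Lemma len_colour x y : colour x = colour y -> len x = len y.
Proof.
have key c d d' : c < 3 -> len (corner c d') = len (corner c d).
  move=> c3; case/connectP: (dart_connect d d') => p.
  elim: p d => [|e p IHp] d /=; first by move=> _ ->.
  case/andP=> /orP[] /eqP -> path_p last_p; rewrite (IHp _ path_p last_p).
    exact: len_corner_alpha.
  by congr order; apply: corner_vert; rewrite ?vert_sigma.
move=> xy; rewrite -(corner_colour x) -(corner_colour y) -xy.
exact/key/colour_lt3.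
Qed.

Lemma colour_lengths (d0 : D) : exists2 ls, perm_eq ls ks &
  forall d, len d = nth 0 ls (colour d).
Proof.
exists [seq len (corner c d0) | c <- iota 0 3]; last first.
  move=> d; rewrite (nth_map 0) ?size_iota ?colour_lt3 // nth_iota ?colour_lt3 //.
  by apply: len_colour; rewrite colour_corner ?colour_lt3.
apply: perm_trans (kind d0).
have -> : [:: len d0; len (sigma d0); len (sigma (sigma d0))] =
    map (fun c => len (corner c d0)) [:: colour d0; colour (sigma d0); colour (sigma (sigma d0))].
  by congr [:: _; _; _]; congr order; apply: corner_eq;
    rewrite ?vert_corner ?vert_sigma ?colour_corner ?colour_lt3.
apply: perm_map; rewrite colour_sigma2.
have := colour_sigma_neq d0; have := colour_lt3 d0; have := colour_lt3 (sigma d0).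
by case: (colour d0) (colour (sigma d0)) => [|[|[|a]]] [|[|[|b]]].
Qed.

End Lengths.

(** * Corner counts inside a contractible cycle *)

(** Corners to the left of the walk at a turn: a left turn has only the corner of the left face
    there, a right turn has all but that of the right face. *)
Definition inside (t : bool) (s : nat * nat) (c : nat) : bool :=
  if t then c == s.1 else c != s.2.

Fixpoint corners (s : nat * nat) (w : seq bool) (c : nat) : nat :=
  if w is t :: w' then inside t s c + corners (turn t s) w' c else 0.

Section Enclosed.
Variables (Fs : {set D}) (f : nat -> nat).
Hypothesis Fs_phi : forall x, (phi x \in Fs) = (x \in Fs).
Hypothesis len_f : forall d, len d = f (colour d).

Definition enclosed (c : nat) (v : V) : bool :=
  [exists x in Fs, (vert x == v) && (colour x == c)].

Lemma enclosed_vert c x : c < 3 -> enclosed c (vert x) = (corner c x \in Fs).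
Proof.
move=> c3; apply/exists_inP/idP => [[y yF /andP[/eqP yx /eqP yc]]|h].
  by rewrite -(corner_vert c3 yx) -yc corner_colour.
by exists (corner c x); rewrite ?vert_corner ?colour_corner ?eqxx.
Qed.

(** Each vertex has one corner of colour [c], and the darts of colour [c] in [Fs] form whole faces
    with [f c] darts each. *)
Lemma card_enclosed c : c < 3 -> f c %| #|[set v | enclosed c v]|.
Proof.
move=> c3; pose K := [set x in Fs | colour x == c].
have -> : #|[set v | enclosed c v]| = #|K|.
  rewrite -(card_in_imset (f := vert) (D := mem K)); last first.
    by move=> x y; rewrite !inE => /andP[_ /eqP xc] /andP[_ /eqP yc] xy; apply: corner_eq; rewrite ?xc.
  apply: eq_card => v; rewrite inE; apply/exists_inP/imsetP.
    by case=> x xF /andP[/eqP <- xc]; exists x; rewrite ?inE ?xF.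
  by case=> x; rewrite !inE => /andP[xF xc] ->; exists x; rewrite ?eqxx.
rewrite -(fcard_order_set phi_inj (n := f c) (a := K)); first exact: dvdn_mull.
  by apply/subsetP => x; rewrite !inE => /andP[_ /eqP <-]; rewrite len_f.
by move=> x y /eqP <-; rewrite !inE Fs_phi colour_phi.
Qed.

(** A set that lies to the left of [d] stays to the left: a turn keeps one bordering face, and every
    dart of the walk separates the set from its complement. *)
Lemma count_enclosed c d w : c < 3 -> d \in Fs -> alpha d \notin Fs ->
  (forall x, x \in walk d w -> (x \in Fs) != (alpha x \in Fs)) ->
  count (enclosed c) (map vert (walk d w)) = corners (state d) w c.
Proof.
move=> c3; elim: w d => //= t w IHw d dF adF bd.
have [eF aeF] : step t d \in Fs /\ alpha (step t d) \notin Fs.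
  have := bd _ (mem_head _ _); case: t {bd} => /=.
    by rewrite Fs_phi dF; case: (_ \in Fs).
  by rewrite -[alpha _ \in Fs]Fs_phi (phi_alpha_step d) (negbTE adF); case: (_ \in Fs).
rewrite -state_step -IHw //; last by move=> x xw; apply: bd; rewrite inE xw orbT.
congr (_ + _); congr nat_of_bool; rewrite enclosed_vert // /inside /=.
have := colour_alpha d; have := colour_lt3 d; have := colour_lt3 (alpha d).
rewrite (corner_vert (y := alpha d) c3 (vert_step _ _)) /corner -/(phi d) colour_phi.
move=> ad3 d3 neq; case: t eF aeF {bd} => /= eF aeF; last first.
  rewrite eq_sym; case: eqVneq => [_|_] /=; first exact: negbTE.
  by case: ifP => // _; rewrite Fs_phi.
case: eqVneq => [ce|nce]; first by rewrite (negbTE adF) -ce (negbTE neq).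
rewrite [colour d == c]eq_sym; case: eqVneq => [//|_].
by rewrite -[sigma _]phi_alpha Fs_phi (negbTE aeF).
Qed.

End Enclosed.

(** * Closed walks and the divisibility satisfied by contractible ones *)

Section ClosedWalks.
Variables (d : D) (w : seq bool).
Hypotheses (w_gt0 : 0 < size w) (closed : walk_end d w = d).
Hypothesis uniq_vert : uniq (map vert (walk d w)).

Lemma last_walk e u : last e (walk e u) = walk_end e u.
Proof. by elim: u e => //= t u IHu e; rewrite IHu. Qed.

Lemma walk_start : d \in walk d w.
Proof. by rewrite -{1}closed -last_walk; case: w w_gt0 => //= t u _; apply: mem_last. Qed.

Lemma walk_next x : x \in walk d w -> exists t, step t x \in walk d w.
Proof.
have [t [u wE]] : exists t u, w = t :: u by case: w w_gt0 => // t u; exists t, u.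
have key e v : x \in walk e v -> x = walk_end e v \/ exists t, step t x \in walk e v.
  elim: v e => //= s v IHv e; rewrite inE => /orP[/eqP xe|/IHv[|[r h]]]; last 2 first.
  - by left.
  - by right; exists r; rewrite inE h orbT.
  rewrite -xe; case: v {IHv} => [|r v] /=; first by left.
  by right; exists r; rewrite !inE eqxx orbT.
case/key => // ->; rewrite closed wE; exists t; exact: mem_head.
Qed.

(** If the walk contained the reverse of its dart [x], that reverse and the successor of [x] would
    start at the same vertex, hence coincide, but a walk never backtracks. *)
Lemma walk_graph_cycle : graph_cycle alpha vert (walk d w).
Proof.
apply/and4P; split=> //; first by case: w w_gt0.
  rewrite (cycle_path d) last_walk closed.
  by elim: (w) (d) => //= t u IHu e; rewrite vert_step eqxx IHu.
rewrite map_inj_in_uniq ?(map_uniq uniq_vert) // => x y xw yw /setP /(_ y).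
rewrite !inE eqxx /= => /orP[/eqP //|/eqP yE]; case: (walk_next xw) => t tw.
case/eqP: (step_neq t x); rewrite -yE; apply: (uniq_map_inj uniq_vert) => //.
by rewrite vert_step yE.
Qed.

(** Here [m] counts the enclosed vertices off the cycle. No edge at such a vertex is on the cycle,
    so its corners are all inside or all outside and [m] serves every colour. *)
Lemma contractible_corners ls :
  (forall d, len d = nth 0 ls (colour d)) ->
  contractible alpha sigma (walk d w) ->
  exists m, forall c, c < 3 -> nth 0 ls c %| m + corners (state d) w c.
Proof.
move=> lenE [Fs0 [closed0 boundary0]].
have [Fs [Fs_phi boundary dF]] : exists Fs : {set D},
  [/\ forall x, (phi x \in Fs) = (x \in Fs),
     forall x, ((x \in Fs) != (alpha x \in Fs)) = ((x \in walk d w) || (alpha x \in walk d w)) &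
     d \in Fs].
  case dF0: (d \in Fs0); first by exists Fs0.
  (* The complement has the same boundary, so the set can be taken to the left of [d]. *)
  exists (~: Fs0); split=> [x|x|]; rewrite !inE ?dF0 ?closed0 // -boundary0.
  by case: (x \in Fs0); case: (_ \in _).
have adF : alpha d \notin Fs.
  by have := boundary d; rewrite dF walk_start; case: (_ \in Fs).
pose C := [set v in map vert (walk d w)].
exists #|[set v | enclosed Fs 0 v] :\: C| => c c3.
suff -> : #|[set v | enclosed Fs 0 v] :\: C| + corners (state d) w c =
          #|[set v | enclosed Fs c v]| by apply: card_enclosed.
rewrite -[RHS](cardsID C) addnC; congr (_ + _).
  rewrite -(count_enclosed Fs_phi c3 dF adF); last first.
    by move=> x xw; rewrite boundary xw.
  rewrite -size_filter -(card_uniqP _) ?filter_uniq //.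
  by apply: eq_card => v; rewrite mem_filter !inE.
have off x : vert x \notin C -> (sigma x \in Fs) = (x \in Fs).
  rewrite -phi_alpha Fs_phi inE => xC; apply/esym/eqP.
  rewrite -[_ == _]negbK boundary; apply/norP; split; apply: contra xC => xw.
    exact: map_f.
  by case: (walk_next xw) => t /(map_f vert); rewrite vert_step alphaK.
apply: eq_card => v; rewrite !inE; case vw: (v \in _) => //=.
case: (pickP (fun x => vert x == v)) => [x /eqP xv|no]; last first.
  by apply/exists_inP/exists_inP => -[x _]; rewrite no.
have all_eq e : e < 3 -> (corner e x \in Fs) = (x \in Fs).
  move=> _; rewrite /corner; case: ifP => // _; case: ifP => _; rewrite !off //;
  by rewrite ?vert_sigma inE xv vw.
by rewrite -xv !enclosed_vert ?all_eq.
Qed.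

End ClosedWalks.

(** * Short cycles *)

(* Two corner counts that are completed by the same number to multiples of the
   respective face lengths agree modulo the gcd of these lengths. *)
Definition balanced (ls : seq nat) (s : nat * nat) (w : seq bool) : bool :=
  all (fun c => all (fun e => corners s w c == corners s w e %[mod gcdn (nth 0 ls c) (nth 0 ls e)])
    (iota 0 3)) (iota 0 3).

Definition closed_state (s : nat * nat) (w : seq bool) : bool :=
  foldl (fun r t => turn t r) s w == s.

Fixpoint words (n : nat) : seq (seq bool) :=
  if n is m.+1 then [seq t :: w | t <- [:: true; false], w <- words m] else [:: [::]].

Lemma mem_words w : w \in words (size w).
Proof. by elim: w => //= t w IHw; case: t; rewrite !mem_cat map_f ?orbT. Qed.

Definition kind_seq (k : lattice_kind) : seq nat :=
  match k with Honeycomb => [:: 6; 6; 6] | L488 => [:: 4; 8; 8] | L4612 => [:: 4; 6; 12] end.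

Lemma balanced_words4 k :
  all (fun ls => all (fun s => all (fun w => closed_state s w && balanced ls s w ==>
    ((w == nseq 4 true) || (w == nseq 4 false))) (words 4)) states) (permutations (kind_seq k)).
Proof. by case: k; vm_compute. Qed.

(** The square lies on side [t] of the starting edge; a first and a last turn [~~ t] leave it at
    both ends of that edge. *)
Lemma balanced_words6 :
  all (fun ls => all (fun s => all (fun w => all (fun t =>
    [&& nth 0 ls (if t then s.1 else s.2) == 4, head t w == ~~ t & last t w == ~~ t] ==>
    ~~ (closed_state s w && balanced ls s w)) [:: true; false]) (words 6)) states)
   (permutations [:: 4; 8; 8]).
Proof. by vm_compute. Qed.

Section ShortCycles.
Variable k : lattice_kind.
Hypothesis kind : kind_ok k alpha sigma.
Hypothesis short : forall p : seq D, graph_cycle alpha vert p ->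
  ~ contractible alpha sigma p -> 8 < size p.

Lemma kind_perm d : perm_eq [:: len d; len (sigma d); len (sigma (sigma d))] (kind_seq k).
Proof. by move: kind; case: (k) => /= h; rewrite ?h. Qed.

Lemma len_mem d : len d \in kind_seq k.
Proof. by rewrite -(perm_mem (kind_perm d)) mem_head. Qed.

Lemma len_ge4 d : 4 <= len d.
Proof. by move: (len_mem d); case: (k) => /=; rewrite !inE => /or3P[] /eqP ->. Qed.

(** Two parallel edges would form a closed walk of two turns. The colours force equal turns, so some
    face would have length at most 2. *)
Lemma dart_inj x y : vert x = vert y -> vert (alpha x) = vert (alpha y) -> x = y.
Proof.
move=> xy axy; apply/eqP/negP => /negP nxy.
have [||t tE] := @step_onto x (alpha y) ; rewrite ?cl //.
  by apply: contraNneq nxy => /alpha_inj ->.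
have [||t' t'E] := @step_onto (alpha y) x; rewrite ?alphaK //.
have cl : walk_end x [:: t; t'] = x by rewrite /= tE.
have tt' : t = t'.
  have : all (fun s => closed_state s [:: t; t'] ==> (t == t')) states by case: (t); case: (t').
  move/allP/(_ _ (state_mem x)); rewrite /closed_state -state_walk_end cl eqxx.
  by move/eqP.
have : len (side_face t x) <= 2.
  by apply: constant_walk_len => //; rewrite -[RHS]cl -tt'.
by rewrite leqNgt (leq_trans _ (len_ge4 _)).
Qed.

(** Contractibility quantifies over finitely many dart sets, hence is decidable, and [short] can be
    contraposed constructively. *)
Lemma short_contractible p : graph_cycle alpha vert p -> size p <= 8 ->
  contractible alpha sigma p.
Proof.
move=> gp sp; case: (boolP [exists Fs : {set D},
    [forall x, (phi x \in Fs) == (x \in Fs)] &&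
    [forall x, ((x \in Fs) != (alpha x \in Fs)) == ((x \in p) || (alpha x \in p))]]).
  case/existsP => Fs /andP[/forallP h1 /forallP h2].
  by exists Fs; split=> x; [exact: (eqP (h1 x))|exact: (eqP (h2 x))].
move=> no; suff : 8 < size p by rewrite ltnNge sp.
apply: short => // -[Fs [h1 h2]]; case/existsP: no; exists Fs.
by apply/andP; split; apply/forallP => x; rewrite ?h1 ?h2.
Qed.

Lemma closed_walk_balanced d w : 0 < size w -> size w <= 8 -> walk_end d w = d ->
  uniq (map vert (walk d w)) ->
  exists2 ls, ls \in permutations (kind_seq k) &
    (forall e, len e = nth 0 ls (colour e)) /\ closed_state (state d) w && balanced ls (state d) w.
Proof.
move=> w0 w8 cl uw; have [ls pls lsE] := colour_lengths kind_perm d.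
exists ls; rewrite ?mem_permutations //; split; rewrite ?cl //.
rewrite /closed_state -state_walk_end cl eqxx /=.
have sz : size (walk d w) = size w by elim: (w) (d) => //= t u IHu e; rewrite IHu.
have [|m mE] := contractible_corners w0 cl uw lsE.
  by apply: short_contractible; rewrite ?sz //; apply: walk_graph_cycle.
apply/allP => c; rewrite mem_iota => /andP[_ c3]; apply/allP => e; rewrite mem_iota => /andP[_ e3].
rewrite -(eqn_modDl m) (eqP (dvdn_trans (dvdn_gcdl _ _) (mE _ c3))).
by rewrite (eqP (dvdn_trans (dvdn_gcdr _ _) (mE _ e3))).
Qed.

(** The enumeration forces four equal turns, so the cycle goes round a face. The conclusion recovers
    [a] and [b] from [t] alone, so each side of [d] carries at most one such cycle. *)
Lemma four_cycle d a b : uniq [:: vert d; vert (alpha d); b; a] ->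
  adj (vert (alpha d)) b -> adj b a -> adj a (vert d) ->
  exists t, [/\ len (side_face t d) = 4, vert (alpha (step t d)) = b &
    exists2 e, vert e = a & step t e = d].
Proof.
move=> un ab ba ad; have := un; rewrite /= !inE !negb_or -!andbA.
case/and5P=> _ db da wb /and3P[wa ba' _].
have [|t1 t1E] := step_adj ab; first by rewrite eq_sym.
have [||t2 t2E] := @step_adj (step t1 d) a; rewrite ?t1E // ?vert_step // 1?eq_sym //.
have [||t3 t3E] := @step_adj (step t2 (step t1 d)) (vert d);
  rewrite ?t2E // ?vert_step ?t1E // 1?eq_sym //.
set e := step t3 _ in t3E.
have eE : vert e = a by rewrite vert_step.
have [||t4 t4E] := @step_onto e d; rewrite ?t3E //.
  by apply: contraNneq wa => ->; rewrite alphaK eE.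
have cl : walk_end d [:: t1; t2; t3; t4] = d by [].
have [|||ls lsP [lsE bal]] := closed_walk_balanced _ _ cl => //.
  (* The walk lists [d] last, whereas the hypothesis lists its vertex first. *)
  by rewrite -(rot_uniq 1) /= -/e t4E eE !vert_step t1E in un *.
have /allP/(_ _ lsP)/allP/(_ _ (state_mem d))/allP/(_ _ (mem_words [:: t1; t2; t3; t4])) := balanced_words4 k.
rewrite bal implyTb => tE.
have wE : [:: t1; t2; t3; t4] = nseq 4 t1 by case/orP: tE => /eqP[-> -> -> ->].
exists t1; split=> //; last by exists e => //; case: wE t4E => _ _ ->.
by apply/eqP; rewrite eqn_leq len_ge4 constant_walk_len -?wE.
Qed.

(** The 4-cycle puts a square on side [t] of [d]; [b' != b] and [a' != a] make the first and last
    turns of the 6-cycle leave it, which the enumeration excludes. *)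
Lemma no_six_cycle d a b a' b' x y : k = L488 ->
  uniq [:: vert d; vert (alpha d); b; a] ->
  adj (vert (alpha d)) b -> adj b a -> adj a (vert d) ->
  uniq [:: vert d; vert (alpha d); b'; y; x; a'] -> a' != a -> b' != b ->
  adj (vert (alpha d)) b' -> adj b' y -> adj y x -> adj x a' -> adj a' (vert d) -> False.
Proof.
move=> k488 un4 ab ba ad un6 a'a b'b ab' b'y yx xa' a'd.
have [t [len4 tb [e0 e0a te0]]] := four_cycle un4 ab ba ad.
have := un6; rewrite /= !inE !negb_or -!andbA.
case/and5P=> _ db' dy dx /and5P[da' wb' wy wx] /and5P[wa' b'y' b'x b'a'] /and4P[yx' ya' xa _].
have [|t1 t1E] := step_adj ab'; first by rewrite eq_sym.
have [||t2 t2E] := @step_adj (step t1 d) y; rewrite ?t1E // ?vert_step // 1?eq_sym //.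
have [||t3 t3E] := @step_adj (step t2 (step t1 d)) x;
  rewrite ?t2E // ?vert_step ?t1E // 1?eq_sym //.
have [||t4 t4E] := @step_adj (step t3 (step t2 (step t1 d))) a';
  rewrite ?t3E // ?vert_step ?t2E // 1?eq_sym //.
have [||t5 t5E] := @step_adj (step t4 (step t3 (step t2 (step t1 d)))) (vert d);
  rewrite ?t4E // ?vert_step ?t3E // 1?eq_sym //.
set e := step t5 _ in t5E.
have eE : vert e = a' by rewrite vert_step.
have [||t6 t6E] := @step_onto e d; rewrite ?t5E //.
  by apply: contraNneq wa' => ->; rewrite alphaK eE.
have cl : walk_end d [:: t1; t2; t3; t4; t5; t6] = d by [].
have [|||ls] := closed_walk_balanced _ _ cl => //.
  by rewrite -(rot_uniq 1) /= -/e t6E eE !vert_step t1E t2E t3E in un6 *.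
rewrite k488 => lsP [lsE bal].
have t1n : t1 = ~~ t.
  case: (t1 =P t) => [E|]; last by case: (t1); case: (t).
  by case/eqP: b'b; rewrite -t1E E.
have t6n : t6 = ~~ t.
  case: (t6 =P t) => [E|]; last by case: (t6); case: (t).
  by case/eqP: a'a; rewrite -eE -e0a; congr vert; apply: (@step_inj t); rewrite te0 -E.
have tm : t \in [:: true; false] by case: (t).
have /allP/(_ _ lsP)/allP/(_ _ (state_mem d))/allP/(_ _ (mem_words [:: t1; t2; t3; t4; t5; t6])) :=
  balanced_words6.
move/allP/(_ _ tm); rewrite bal /= t1n t6n eqxx.
by move: len4; rewrite lsE; case: (t) => /= ->.
Qed.

(** * The super-plaquette algorithm *)

Notation oe := (oe alpha).
Notation edg := (edg alpha).
Notation face_of := (face_of alpha sigma).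
Notation FG := (FG alpha sigma).
Notation ecol0 := (ecol0 alpha col).

Definition ends_of (d : D) : {set V} := [set vert d; vert (alpha d)].

Lemma ends_edg d b : ends vert (edg d, b) = ends_of d.
Proof. by rewrite /ends /= imsetU !imset_set1. Qed.

Lemma ends_of_alpha d : ends_of (alpha d) = ends_of d.
Proof. by rewrite /ends_of alphaK setUC. Qed.

Lemma ends_of_inj x y : ends_of x = ends_of y -> y = x \/ y = alpha x.
Proof.
move=> xy; have /setP/(_ (vert y)) := xy; have /setP/(_ (vert (alpha y))) := xy.
rewrite !inE !eqxx orbT /= => h1 h2; have := vert_alpha y.
case/orP: h1 => /eqP h1; case/orP: h2 => /eqP h2; rewrite h1 h2 ?eqxx // => _.
  by right; apply: dart_inj; rewrite ?alphaK.
by left; apply: dart_inj.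
Qed.

Lemma edg_eq x y : (edg x == edg y) = (y == x) || (y == alpha x).
Proof.
apply/eqP/orP => [/setP/(_ y)|[] /eqP -> //].
  by rewrite !inE eqxx /= => /orP.
by rewrite /Defs.edg alphaK setUC.
Qed.

Lemma oe_eq x y : (oe x == oe y) = (y == x) || (y == alpha x).
Proof. by rewrite -edg_eq xpair_eqE andbT. Qed.

Lemma colour_fconnect x y : fconnect phi x y -> colour y = colour x.
Proof. by move=> h; rewrite -(iter_findex h); elim: findex => //= n IHn; rewrite colour_phi. Qed.

Lemma mem_face_of x d : (oe x \in face_of d) = fconnect phi d x || fconnect phi d (alpha x).
Proof.
apply/imsetP/orP => [[y]|].
  by rewrite inE => dy /eqP; rewrite oe_eq => /orP[] /eqP yx; rewrite -yx; [left|right].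
case=> h; [exists x|exists (alpha x)]; rewrite ?inE //.
by apply/eqP; rewrite oe_eq eqxx orbT.
Qed.

Lemma face_of_fconnect x y : fconnect phi x y -> face_of x = face_of y.
Proof.
move=> xy; rewrite /Defs.face_of.
suff -> : [set z | fconnect phi x z] = [set z | fconnect phi y z] by [].
by apply/setP => z; rewrite !inE (same_connect (fconnect_sym phi_inj) xy).
Qed.

(** Makes the colour of a face, given as an edge set, well defined. If neither [x] nor [phi x] lay
    on the face of [y], their reverses both would, but these differ in colour. *)
Lemma face_of_colour x y : face_of x = face_of y -> colour x = colour y.
Proof.
move=> xy; have : oe x \in face_of y by rewrite -xy mem_face_of connect0.
have : oe (phi x) \in face_of y by rewrite -xy mem_face_of fconnect1.
rewrite !mem_face_of => /orP[/colour_fconnect|/colour_fconnect]; rewrite ?colour_phi // => h1.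
case/orP=> /colour_fconnect // h2; move: h1; rewrite colour_alpha_phi h2.
have := colour_alpha x; have := colour_lt3 x; have := colour_lt3 y; rewrite h2; lia.
Qed.

Lemma fcolG_face_of x : fcolG alpha sigma col (face_of x) = col x.
Proof.
rewrite /fcolG; case: pickP => [y /eqP/face_of_colour h|/(_ x)]; last by rewrite eqxx.
exact/val_inj.
Qed.

Lemma ecol0_oe x : ecol0 (oe x) = 3 - colour x - colour (alpha x) :> nat.
Proof.
have tE y : third (col y) (col (alpha y)) = 3 - colour y - colour (alpha y) :> nat.
  have := colour_alpha y; rewrite eq_sym => ny.
  have := @third_eq (col y) (col (alpha y)) (third (col y) (col (alpha y))) ny.
  rewrite eqxx -!val_eqE /= => /esym/andP[].
  have := ltn_ord (third (col y) (col (alpha y))).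
  have := colour_lt3 y; have := colour_lt3 (alpha y); rewrite /colour in ny *; lia.
rewrite /Defs.ecol0; case: pickP => [y|/(_ x)]; last by rewrite !inE eqxx.
by rewrite !inE => /orP[] /eqP ->; rewrite tE ?alphaK //; lia.
Qed.

(** * Edges kept and edges removed by the algorithm *)

Section Defect.
Variable d0 : D.

Notation kept_edges := (edges' alpha sigma vert col d0).
Notation shrink := (shrink alpha sigma d0).
Notation merge := (Defs.merge alpha sigma col d0).

Definition colourD : nat := 3 - colour d0 - colour (alpha d0).

Lemma sp_D_val : sp_D alpha col d0 = colourD :> nat.
Proof. exact: ecol0_oe. Qed.

Definition on_shrink (x : D) : bool := (oe x \in face_of d0) || (oe x \in face_of (alpha d0)).

Lemma mem_shrink F : (F \in shrink) = (F == face_of d0) || (F == face_of (alpha d0)).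
Proof.
rewrite inE; apply/andP/orP => [[/imsetP[y _ ->]]|].
  rewrite mem_face_of => /orP[] /face_of_fconnect ->; rewrite eqxx; by [left|right].
case=> /eqP ->; rewrite mem_face_of connect0 ?orbT; split=> //;
  exact: imset_f.
Qed.

Lemma on_shrinkP x : reflect (exists2 S, S \in shrink & oe x \in S) (on_shrink x).
Proof.
apply: (iffP orP) => [[] h|[S]].
- by exists (face_of d0); rewrite ?mem_shrink ?eqxx.
- by exists (face_of (alpha d0)); rewrite ?mem_shrink ?eqxx ?orbT.
by rewrite mem_shrink => /orP[] /eqP ->; [left|right].
Qed.

Lemma on_shrink_dart x : on_shrink x -> exists p s,
  [/\ p = x \/ p = alpha x, s = d0 \/ s = alpha d0 & fconnect phi s p].
Proof.
rewrite /on_shrink !mem_face_of => /orP[] /orP[] h.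
- by exists x, d0; split=> //; left.
- by exists (alpha x), d0; split=> //; [right|left].
- by exists x, (alpha d0); split=> //; [left|right].
- by exists (alpha x), (alpha d0); split=> //; right.
Qed.

Lemma FG_original F f : F \in FG -> f \in F -> f.2 = false.
Proof. by case/imsetP => y _ -> /imsetP[z _ ->]. Qed.

(** Closed form of survival: the edge avoids both deleted vertices, and it has the defect colour or
    lies on no shrink face. *)
Definition edge_kept (x : D) : bool :=
  [&& vert d0 \notin ends_of x, vert (alpha d0) \notin ends_of x &
      (3 - colour x - colour (alpha x) == colourD) || ~~ on_shrink x].

(** A doubled edge survives through its pair face, an edge off the shrink faces through one of its
    two faces that is not of the defect colour. *)
Lemma kept_edge_mem x : edge_kept x -> oe x \in kept_edges.
Proof.
case/and3P=> ux wx cx; rewrite inE ends_edg ux wx inE imset_f //= andbT.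
case on: (on_shrink x) cx; rewrite ?orbT ?orbF => cx.
  have dbl : oe x \in doubled alpha sigma vert col d0.
    rewrite inE imset_f //= ends_edg ux wx -val_eqE /= ecol0_oe sp_D_val cx !andbT.
    by apply/exists_inP; apply/on_shrinkP.
  have notFG : [set oe x; copy (oe x)] \notin FG.
    by apply/negP => /FG_original/(_ (set22 _ _)).
  apply/exists_inP; exists [set oe x; copy (oe x)]; last by rewrite !inE eqxx.
  have pf : [set oe x; copy (oe x)] \in pair_faces alpha sigma vert col d0 by exact: imset_f.
  rewrite in_setD in_setU in_setD in_setU pf orbT andbT.
  by rewrite [_ \in merge]inE [_ \in shrink]inE (negbTE notFG).
have [y yx yc] : exists2 y, oe y = oe x & colour y != colourD.
  case: (eqVneq (colour x) colourD) => [xc|nc]; last by exists x.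
  exists (alpha x); last by rewrite -xc colour_alpha.
  by apply/eqP; rewrite oe_eq alphaK eqxx orbT.
have yF : oe x \in face_of y by rewrite -yx mem_face_of connect0.
apply/exists_inP; exists (face_of y) => //.
have nS : face_of y \notin shrink.
  by apply: contraFN on => yS; apply/on_shrinkP; exists (face_of y).
rewrite in_setD [_ \in merge]inE fcolG_face_of -val_eqE /= sp_D_val (negbTE yc) andbF /=.
by rewrite in_setU in_setD nS in_setU imset_f.
Qed.

Lemma kept_edge_dart f : f \in kept_edges -> exists z b, f = (edg z, b).
Proof.
rewrite inE => /andP[]; rewrite in_setU => /orP[/imsetP[z _ ->]|/imsetP[g gd ->]] _.
  by exists z, false.
by move: gd; rewrite inE => /andP[/imsetP[z _ ->] _]; exists z, true.
Qed.

(** An edge of another colour on a shrink face has a face of the defect colour on its other side.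
    That one is a merge face, so both are deleted, and no new face contains the edge. *)
Lemma mem_kept_edge x b : (edg x, b) \in kept_edges -> edge_kept x.
Proof.
rewrite inE !ends_edg => /and4P[xE xF ux wx]; rewrite /edge_kept ux wx /=.
case: eqP => //= /eqP cx; apply/negP => on.
have ndbl c : (edg x, c) \notin doubled alpha sigma vert col d0.
  apply: contra cx => h; have : (edg x, c) = oe x.
    by move: h; rewrite inE => /andP[/imsetP[z _ /(congr1 snd) /= ->]].
  by move=> E; move: h; rewrite E inE -val_eqE /= ecol0_oe sp_D_val => /and3P[_ _ /andP[]].
have bE : b = false.
  move: xE; rewrite inE => /orP[/imsetP[z _ [_ ->]] //|/imsetP[f fd [E _]]].
  by case/negP: (ndbl f.2); rewrite E -surjective_pairing.
move: xF; rewrite bE -/(oe x) => /exists_inP[F]; rewrite in_setD => /andP[nM].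
have nbig : oe x \notin big_face alpha sigma vert col d0.
  rewrite !inE negb_or; apply/andP; split.
    by apply/imsetP => -[f _ []].
  rewrite negb_and; apply/orP; right; apply/forall_inPn.
  by case/on_shrinkP: on => S SS xS; exists S => //; rewrite negbK.
rewrite in_setU in_setD in_set1 in_setU => /orP[/andP[nS FE]|/eqP -> xF]; last by rewrite xF in nbig.
case/orP: FE => [FF xF|/imsetP[f fd -> ]]; last first.
  rewrite !inE => /orP[] /eqP E; first by case/negP: (ndbl false); rewrite -/(oe x) E.
  by have := congr1 snd E.
case/imsetP: FF xF nS nM => y _ -> xF nS; rewrite inE fcolG_face_of imset_f //= negb_and.
case/orP; last first.
  case/negP; apply/exists_inP; case/on_shrinkP: on => S SS xS; exists S => //.
  by apply/exists_inP; exists (oe x).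
rewrite -val_eqE /= sp_D_val -/(colour y) => /eqP; apply.
have [p [s [pE sE sp]]] := on_shrink_dart on.
have yp : ~~ fconnect phi y p.
  apply: contra nS => yp; rewrite mem_shrink (face_of_fconnect yp) -(face_of_fconnect sp).
  by case: sE => ->; rewrite eqxx ?orbT.
have /colour_fconnect <- : fconnect phi y (alpha p).
  by move: xF yp; rewrite mem_face_of; case: pE => ->; rewrite ?alphaK => /orP[] ->.
have := colour_fconnect sp; move: cx; rewrite /colourD.
have := colour_alpha d0; have := colour_lt3 d0; have := colour_lt3 (alpha d0).
have := colour_alpha x; have := colour_lt3 x; have := colour_lt3 (alpha x).
by case: pE => ->; case: sE => ->; rewrite ?alphaK; lia.
Qed.

(* One dart for each edge that the algorithm removes: the defect edge, and the
   edges between a shrink face and a merge face. *)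
Definition removed_darts : {set D} :=
  d0 |: ([set x | fconnect phi d0 x & colour (alpha x) == colourD] :|:
         [set x | fconnect phi (alpha d0) x & colour (alpha x) == colourD]).

Lemma colourD_neq : (colour d0 != colourD) && (colour (alpha d0) != colourD).
Proof.
have := colour_alpha d0; have := colour_lt3 d0; have := colour_lt3 (alpha d0).
by rewrite /colourD; lia.
Qed.

Lemma removed_dart_face s x : s = d0 \/ s = alpha d0 -> fconnect phi s x ->
  colour (alpha x) = colourD -> x \in removed_darts.
Proof. by move=> sE sx /eqP xc; rewrite !inE xc !andbT; case: sE sx => -> ->; rewrite !orbT. Qed.

(** At either end of the defect edge, the two other edges separate a shrink face from the third
    face, which has the defect colour. *)
Lemma removed_dart_vert s y : s = d0 \/ s = alpha d0 -> vert y = vert s ->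
  (y \in removed_darts) || (alpha y \in removed_darts).
Proof.
move=> sE /esym/eqP; rewrite vert_eq !in_cons in_nil orbF.
have sD : colourD = 3 - colour s - colour (alpha s).
  by case: sE => ->; rewrite /colourD ?alphaK //; lia.
have sE' : alpha s = d0 \/ alpha s = alpha d0 by case: sE => ->; rewrite ?alphaK; auto.
have R0 : d0 \in removed_darts by rewrite !inE eqxx.
case/or3P=> /eqP ->.
- by case: sE => ->; rewrite ?alphaK R0 ?orbT.
- apply/orP; left; apply: (removed_dart_face sE').
    by rewrite -phi_alpha fconnect1.
  by rewrite -phi_alpha colour_alpha_phi alphaK sD; lia.
apply/orP; right; apply: (removed_dart_face sE).
  by have := fconnect1 phi (alpha (sigma (sigma s))); rewrite phi_alpha sigma3 (fconnect_sym phi_inj).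
by rewrite alphaK colour_sigma2 colour_sigma sD.
Qed.

Lemma edge_kept_alpha x : edge_kept (alpha x) = edge_kept x.
Proof.
have oeE : oe (alpha x) = oe x by apply/eqP; rewrite oe_eq alphaK eqxx orbT.
rewrite /edge_kept ends_of_alpha /on_shrink oeE alphaK.
by congr [&& _, _ & (_ == _) || _]; lia.
Qed.

Lemma removed_dart_not_kept x : x \in removed_darts -> ~~ edge_kept x.
Proof.
case/andP: colourD_neq => n1 n2.
rewrite !inE /edge_kept => /or3P[/eqP ->|/andP[xc /eqP ac]|/andP[xc /eqP ac]];
  first by rewrite !inE eqxx.
all: rewrite ac (colour_fconnect xc) /on_shrink !mem_face_of xc ?orbT orbF !negb_and.
all: have := colour_alpha d0; have := colour_lt3 d0; have := colour_lt3 (alpha d0).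
all: by move=> *; do 2 (apply/orP; right); rewrite /colourD in n1 n2 *; lia.
Qed.

Lemma not_kept_removed x : ~~ edge_kept x -> (x \in removed_darts) || (alpha x \in removed_darts).
Proof.
case/andP: colourD_neq => n1 n2.
have l0 := colour_lt3 d0; have l1 := colour_lt3 (alpha d0); have c0 := colour_alpha d0.
have R s y : s = d0 \/ s = alpha d0 -> vert s \in ends_of y ->
    (y \in removed_darts) || (alpha y \in removed_darts).
  move=> sE; rewrite in_set2 => /orP[] /eqP ys; first exact: (removed_dart_vert sE).
  by rewrite orbC; have := removed_dart_vert sE (esym ys); rewrite alphaK.
rewrite !negb_and !negbK => /or3P[/R|/R|]; [by apply; left|by apply; right|].
rewrite negb_or negbK => /andP[cx /on_shrink_dart[p [s [pE sE sp]]]].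
have pR : p \in removed_darts.
  apply: (removed_dart_face sE sp); have := colour_fconnect sp; move: cx n1 n2.
  have := colour_alpha x; have := colour_lt3 x; have := colour_lt3 (alpha x).
  by rewrite /colourD; case: pE => ->; case: sE => ->; rewrite ?alphaK; lia.
by case: pE pR => -> ->; rewrite ?orbT.
Qed.

(** The colours across the face alternate, so [phi] exchanges this half of its darts with the other
    half. *)
Lemma card_face_darts d n : n = 3 - colour d - colour (alpha d) ->
  2 * #|[set x | fconnect phi d x & colour (alpha x) == n]| = len d.
Proof.
move=> nE; set A := [set x | _ & _]; pose S := [set x | fconnect phi d x].
have -> : len d = #|S| by rewrite cardsE.
rewrite -[RHS](cardsID A) mul2n -addnn; have /setIidPr -> : A \subset S.
  by apply/subsetP => x; rewrite !inE => /andP[].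
congr (_ + _); rewrite -(card_imset A phi_inj); apply: eq_card => x.
have dphi y : fconnect phi d (phi y) = fconnect phi d y.
  by rewrite [LHS](fconnect_sym phi_inj) -(same_fconnect1 phi_inj) (fconnect_sym phi_inj).
have ex y : fconnect phi d y -> (colour (alpha (phi y)) != n) = (colour (alpha y) == n).
  move/colour_fconnect; rewrite colour_alpha_phi nE.
  have := colour_alpha y; have := colour_lt3 y; have := colour_lt3 (alpha y).
  have := colour_alpha d; have := colour_lt3 d; have := colour_lt3 (alpha d).
  lia.
have [y ->] : exists y, x = phi y by exists (finv phi x); rewrite f_finv //; apply: phi_inj.
rewrite mem_imset; last exact: phi_inj.
by rewrite !inE dphi; case h: (fconnect phi d y); rewrite ?andbF //= andbT -ex.
Qed.

Lemma card_removed_darts : 2 * #|removed_darts| = (len d0 + len (alpha d0)).+2.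
Proof.
have c0 := colour_alpha d0; have l0 := colour_lt3 d0; have l1 := colour_lt3 (alpha d0).
rewrite cardsU1 cardsU (_ : _ :&: _ = set0) ?cards0; last first.
  apply/setP => x; rewrite !inE; apply/negP => /andP[/andP[/colour_fconnect h _]].
  by case/andP=> /colour_fconnect h' _; move: c0; rewrite -h -h' eqxx.
rewrite (_ : d0 \notin _); last first.
  by rewrite !inE -andb_orl negb_and; apply/orP; right; rewrite /colourD; lia.
rewrite -(card_face_darts (d := d0) (n := colourD)) // -(card_face_darts (d := alpha d0) (n := colourD)).
  by rewrite subn0 !mulnDr muln1.
by rewrite alphaK /colourD; lia.
Qed.

(** No removed dart has the defect colour, but all of them except [d0] have a reverse of that
    colour, so no edge is listed twice. *)
Lemma removed_dart_inj : {in removed_darts &, injective ends_of}.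
Proof.
case/andP: colourD_neq => n1 n2.
have R z : z \in removed_darts -> (z = d0 \/ colour (alpha z) = colourD) /\ colour z != colourD.
  rewrite !inE => /or3P[/eqP ->|/andP[h /eqP ac]|/andP[h /eqP ac]]; first by split; [left|].
    by rewrite (colour_fconnect h); split; [right|].
  by rewrite (colour_fconnect h); split; [right|].
move=> x y /R[xR xn] /R[yR yn] /ends_of_inj[-> //|yE].
move: yR yn; rewrite yE alphaK => yR yn; have := alpha_neq d0.
case: xR yn yR => [->|->]; last by rewrite eqxx.
by move=> _ [->|e]; [rewrite eqxx|rewrite e eqxx in n1].
Qed.

Lemma removed_connections_super_plaquette :
  2 * removed_connections adj (adj' alpha sigma vert col d0) = (len d0 + len (alpha d0)).+2.
Proof.
rewrite -card_removed_darts -(card_in_imset removed_dart_inj); congr (2 * _).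
apply: eq_card => s; rewrite inE; apply/existsP/imsetP.
  case=> x /existsP[y /and3P[/eqP -> /existsP[d /andP[/eqP <- /eqP <-]] nadj]].
  have /not_kept_removed/orP[dR|dR] : ~~ edge_kept d.
  - apply: contra nadj => /kept_edge_mem dk.
    by apply/exists_inP; exists (oe d); rewrite // ends_edg.
  - by exists d.
  by exists (alpha d); rewrite // ends_of_alpha.
case=> d dR ->; exists (vert d); apply/existsP; exists (vert (alpha d)).
rewrite eqxx adj_dart /=; apply/negP => /exists_inP[f fk /eqP fE].
have [z [b fz]] := kept_edge_dart fk.
move: fk fE; rewrite fz ends_edg => /mem_kept_edge zk /esym/ends_of_inj zE.
have := removed_dart_not_kept dR; case: zE zk => ->; rewrite ?edge_kept_alpha => -> //.
Qed.

End Defect.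
(** * Lower bound for competing lattices *)

Section Competitor.
(** The dart [d] leads from the removed vertex to the neighbour that the competitor removes; it need
    not carry the defect edge. *)
Variables (d : D) (DH : finType) (aH sH : DH -> DH) (vH : DH -> V).
Notation u := (vert d).
Notation w := (vert (alpha d)).
Notation adjH := (map_adj aH vH).
Hypothesis torusH : is_torus_map aH sH vH.
Hypothesis trivalentH : trivalent sH.
Hypothesis vertsH : map_vertices vH = map_vertices vert :\ u :\ w.
Hypothesis adj_H : forall e, adj (vH e) (vH (aH e)).

Definition mult (x y : V) : nat := #|[set e | (vH e == x) && (vH (aH e) == y)]|.

Lemma aHK : involutive aH. Proof. by case: torusH => [_ []]. Qed.

Lemma mult_sym x y : mult x y = mult y x.
Proof.
rewrite /mult -(card_imset _ (can_inj aHK)); apply: eq_card => e.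
by rewrite -[e in LHS]aHK mem_imset; [rewrite !inE aHK andbC|exact: can_inj aHK].
Qed.

Lemma adjHE x y : adjH x y = (0 < mult x y).
Proof.
rewrite card_gt0; apply/existsP/set0Pn => -[e h]; exists e; move: h; by rewrite inE.
Qed.

Lemma vertH x : (vert x \in map_vertices vH) = (vert x != u) && (vert x != w).
Proof. by rewrite vertsH !inE imset_f ?inE // andbT andbC. Qed.

Lemma mult_gt0 x y : 0 < mult x y -> [/\ y != u, y != w & adj x y].
Proof.
rewrite -adjHE => /existsP[e /andP[/eqP <- /eqP <-]].
have : vH (aH e) \in map_vertices vH by rewrite imset_f ?inE.
by rewrite vertsH !inE => /and3P[-> ->].
Qed.

Lemma mult_out x y : (y == u) || (y == w) -> mult x y = 0.
Proof.
move=> h; apply/eqP; rewrite -leqn0 leqNgt; apply/negP => /mult_gt0[/negbTE a /negbTE b].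
by rewrite a b in h.
Qed.

Lemma card_star e : #|[set e' | vH e' == vH e]| = 3.
Proof.
case: torusH => [_ [_ [_ [vfc _]]]]; rewrite -(trivalentH e) /order.
by apply: eq_card => e'; rewrite inE eq_sym vfc.
Qed.

Lemma star_neq x : [/\ vert (alpha (sigma x)) != vert (alpha x),
  vert (alpha (sigma (sigma x))) != vert (alpha x) &
  vert (alpha (sigma (sigma x))) != vert (alpha (sigma x))].
Proof.
split; apply/eqP => /dart_inj; rewrite !alphaK !vert_sigma => /(_ erefl)/alpha_inj; apply/eqP.
- exact: sigma_neq.
- by rewrite -{2}(sigma3 x) eq_sym sigma_neq.
exact: sigma_neq.
Qed.

Lemma adj_star x y : adj (vert x) y ->
  y \in [:: vert (alpha x); vert (alpha (sigma x)); vert (alpha (sigma (sigma x)))].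
Proof.
case/existsP=> e /andP[]; rewrite eq_sym vert_eq !inE => h /eqP <-.
by case/or3P: h => /eqP ->; rewrite eqxx ?orbT.
Qed.

(** The competitor has degree 3 at the vertex, and its edges there lead only to the three lattice
    neighbours. *)
Lemma mult_sum x : vert x != u -> vert x != w ->
  mult (vert x) (vert (alpha x)) + mult (vert x) (vert (alpha (sigma x))) +
  mult (vert x) (vert (alpha (sigma (sigma x)))) = 3.
Proof.
move=> xu xw; have /imsetP[e _ eE] : vert x \in map_vertices vH by rewrite vertH xu.
have [n1 n2 n3] := star_neq x.
have mE y : mult (vert x) y = \sum_(e' | vH e' == vert x) (vH (aH e') == y).
  rewrite /mult -sum1dep_card big_mkcondr; apply: eq_bigr => e' _; by case: ifP.
rewrite !mE -!big_split /= -(card_star e) -eE -sum1dep_card; apply: eq_bigr => e' /eqP e'E.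
have := adj_H e'; rewrite e'E => /adj_star; rewrite !inE => /or3P[] /eqP ->.
- by rewrite eqxx eq_sym (negbTE n1) eq_sym (negbTE n2).
- by rewrite (negbTE n1) eqxx eq_sym (negbTE n3).
by rewrite (negbTE n2) (negbTE n3) eqxx.
Qed.

Definition outer (v : V) : bool := [&& v != u, v != w & adj v u || adj v w].

Definition neighbours : seq V := [:: vert (alpha (sigma d)); vert (alpha (sigma (sigma d)));
  vert (alpha (sigma (alpha d))); vert (alpha (sigma (sigma (alpha d))))].

Lemma outer_neighbours v : v \in neighbours -> outer v.
Proof.
have [n1 n2 _] := star_neq d; have [] := star_neq (alpha d); rewrite alphaK => n3 n4 _.
have h x y : vert x = y -> (vert (alpha x) != y) && adj (vert (alpha x)) y.
  by move=> <-; rewrite vert_alpha adj_sym adj_dart.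
have [h1 h2] := (h (sigma d) u (vert_sigma d), h (sigma (alpha d)) w (vert_sigma _)).
have h3 := h (sigma (sigma d)) u (etrans (vert_sigma _) (vert_sigma _)).
have h4 := h (sigma (sigma (alpha d))) w (etrans (vert_sigma _) (vert_sigma _)).
rewrite !inE => /or4P[] /eqP ->; apply/and3P; split=> //;
  by move: h1 h2 h3 h4 => /andP[? ?] /andP[? ?] /andP[? ?] /andP[? ?]; rewrite // ?orbT; apply/orP; auto.
Qed.

Lemma outerE v : outer v -> exists2 x, v = vert (alpha x) & (vert x == u) || (vert x == w).
Proof.
by case/and3P=> _ _ /orP[] /existsP[x /andP[/eqP <- h]]; exists (alpha x); rewrite ?alphaK ?h ?orbT.
Qed.

Lemma neighbours_uniq : uniq neighbours.
Proof.
have [_ _ n1] := star_neq d; have [_ _ n2] := star_neq (alpha d).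
have op x y : side (vert x) != side (vert y) -> vert x != vert y.
  by apply: contraNneq => ->.
rewrite /= !inE !negb_or [_ == vert (alpha (sigma (sigma d)))]eq_sym n1.
rewrite [vert (alpha (sigma (alpha d))) == _]eq_sym n2 !op //;
  by rewrite !side_vert !(chirality_alpha, chirality_sigma); case: chirality.
Qed.

(** A triple edge would be a whole component of the connected competitor, which has at least the
    four vertices of [neighbours]. *)
Lemma mult_le2 x y : mult x y <= 2.
Proof.
case: (posnP (mult x y)) => [-> //|m0].
rewrite leqNgt; apply/negP => m3.
have full p q : 2 < mult p q -> forall e, vH e = p -> vH (aH e) = q.
  move=> m e ep; apply/eqP; have : [set e' | (vH e' == p) && (vH (aH e') == q)] == [set e' | vH e' == p].
    have st : #|[set e' | vH e' == p]| = 3 by rewrite -ep card_star.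
    rewrite eqEcard st m andbT.
    by apply/subsetP => e'; rewrite !inE => /andP[].
  by move/eqP/setP/(_ e); rewrite !inE ep eqxx /=.
have closed e e' : vH e \in [:: x; y] -> vH e' \in [:: x; y].
  case: torusH => [_ [_ [_ [vfc [_ [con _]]]]]] eI.
  case/connectP: (con e e') => p; elim: p e eI => [|f p IHp] e eI /=; first by move=> _ ->.
  case/andP=> ef pp lp; apply: (IHp f) => //; case/orP: ef => /eqP ->.
    move: eI; rewrite !inE => /orP[] /eqP eI.
      by rewrite (full x y) ?eqxx ?orbT.
    by rewrite (full y x) ?eqxx // mult_sym.
  suff -> : vH (sH e) = vH e by [].
  by apply/esym/eqP; rewrite vfc fconnect1.
have /card_gt0P[e] := m0; rewrite inE => /andP[/eqP ex _].
have inxy v : v != u -> v != w -> v \in map_vertices vert -> v \in [:: x; y].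
  move=> vu vw vV; have : v \in map_vertices vH by rewrite vertsH !inE vu vw vV.
  by case/imsetP=> e' _ ->; apply: (closed e); rewrite ex mem_head.
suff : size neighbours <= size [:: x; y] by [].
apply: uniq_leq_size neighbours_uniq _ => v vn; have /and3P[vu vw _] := outer_neighbours vn.
by apply: inxy => //; have /outerE[f -> _] := outer_neighbours vn; rewrite imset_f ?inE.
Qed.

(** One lattice neighbour of [q] is gone; two multiplicities of at most 2 then add up to 3. *)
Lemma partner q : outer q -> exists x, mult q x = 2.
Proof.
move=> oq; have [x qE xuw] := outerE oq; case/and3P: oq => qu qw _.
have := mult_sum (x := alpha x); rewrite alphaK -qE (mult_out _ xuw) => /(_ qu qw).
set y := vert (alpha (sigma _)); set z := vert (alpha (sigma (sigma _))).
have := mult_le2 q y; have := mult_le2 q z; case: (eqVneq (mult q y) 2) => [|n] *; first by exists y.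
by exists z; lia.
Qed.

Lemma partner_out q x : mult q x = 2 -> [/\ x != u, x != w, adj q x & adj x q].
Proof.
move=> m; have [|xu xw qx] := @mult_gt0 q x; rewrite ?m //.
by split; rewrite // adj_sym.
Qed.

(** Two double edges at one vertex would exceed degree 3. *)
Lemma partner_neq q q' x x' : q != q' -> mult q x = 2 -> mult q' x' = 2 -> x != x'.
Proof.
move=> qq' m; apply: contra_eq_neq => <- {x'}.
have [xu xw _ xq] := partner_out m; have /existsP[z /andP[/eqP zx _]] := xq.
apply/negP => /eqP m'; have [_ _ _ xq'] := partner_out m'.
move: xq xq' xu xw m m'; rewrite -zx ![mult _ (vert z)]mult_sym => /adj_star h /adj_star h' zu zw.
have := mult_sum zu zw; move: h h' qq'; rewrite !inE.
by case/or3P=> /eqP ->; case/or3P=> /eqP ->; rewrite ?eqxx // => _; lia.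
Qed.

(** * Removed connections at and away from the deleted vertices *)

Definition removed_pairs : {set {set V}} :=
  [set s : {set V} | [exists x, exists y, [&& s == [set x; y], adj x y & ~~ adjH x y]]].

Definition extra_pairs : {set {set V}} := [set s in removed_pairs | (u \notin s) && (w \notin s)].

Lemma mem_removed_pairs x y : adj x y -> ~~ adjH x y -> [set x; y] \in removed_pairs.
Proof.
move=> xy nxy; rewrite inE; apply/existsP; exists x.
by apply/existsP; exists y; rewrite eqxx xy.
Qed.

(** The double edge leaves one further edge for the two other neighbours of [x], so one of them is
    lost; it is not a deleted vertex because [x] is not outer. *)
Lemma extra_pair q x : mult q x = 2 -> ~~ outer x -> exists2 s, s \in extra_pairs & x \in s.
Proof.
move=> m; have [xu xw _ xq] := partner_out m; rewrite /outer xu xw /= negb_or => /andP[nu nw].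
suff [y xy m0] : exists2 y, adj x y & mult x y = 0.
  have yu : y != u by apply: contraNneq nu => <-.
  have yw : y != w by apply: contraNneq nw => <-.
  exists [set x; y]; last by rewrite !inE eqxx.
  rewrite inE mem_removed_pairs ?adjHE ?m0 //= !inE ![_ == x]eq_sym ![_ == y]eq_sym.
  by rewrite (negbTE xu) (negbTE xw) (negbTE yu) (negbTE yw).
case/existsP: xq => z /andP[/eqP zx /eqP zq]; move: xu xw m; rewrite -zx -zq mult_sym => zu zw.
have := mult_sum zu zw => S M.
have a1 : adj (vert z) (vert (alpha (sigma z))) by rewrite -(vert_sigma z) adj_dart.
have a2 : adj (vert z) (vert (alpha (sigma (sigma z)))).
  by rewrite -(vert_sigma z) -(vert_sigma (sigma z)) adj_dart.
case: (posnP (mult (vert z) (vert (alpha (sigma z))))) => [m0|mp].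
  by exists (vert (alpha (sigma z))).
by exists (vert (alpha (sigma (sigma z)))) => //; lia.
Qed.

Lemma removed_pairs_card : 5 + #|extra_pairs| <= removed_connections adj adjH.
Proof.
(* Three darts at each deleted vertex, with the edge between them taken once: 3 + 3 - 1 = 5. *)
pose X := [set x | vert x == u] :|: [set x | vert x == w] :\ alpha d.
have star x : #|[set y | vert y == vert x]| = 3.
  by rewrite -(order_sigma x) /order; apply: eq_card => y; rewrite inE eq_sym vert_fconnect.
have uw : u != w by rewrite eq_sym vert_alpha.
have X5 : #|X| = 5.
  rewrite cardsU (_ : _ :&: _ = set0) ?cards0; last first.
    by apply/setP => x; rewrite !inE; case: (eqVneq (vert x) u) => // ->; rewrite (negbTE uw) andbF.
  have := cardsD1 (alpha d) [set x | vert x == w]; rewrite !star inE eqxx; lia.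
have Xinj : {in X &, injective ends_of}.
  move=> x y xX yX /ends_of_inj[-> //|yE]; move: xX yX; rewrite yE !inE.
  have va := vert_alpha x.
  case/orP=> [/eqP xu|/andP[xd /eqP xw]]; case/orP=> [/eqP yu|/andP[yd /eqP yw]].
  - by rewrite xu yu eqxx in va.
  - by case/eqP: yd; congr alpha; apply: dart_inj.
  - by case/eqP: xd; apply: dart_inj; rewrite ?alphaK.
  by rewrite xw yw eqxx in va.
rewrite -X5 -(card_in_imset Xinj) -cardsUI.
set I := _ :&: _; have -> : I = set0.
  apply/setP => s; rewrite in_setI in_set0; apply/negP => /andP[/imsetP[x xX ->]].
  rewrite inE => /and3P[_]; move: xX; rewrite !in_set2 !inE !negb_or.
  by case/orP=> [/eqP ->|/andP[_ /eqP ->]]; rewrite eqxx.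
rewrite cards0 addn0; apply: subset_leq_card; rewrite subUset; apply/andP; split; last first.
  by apply/subsetP => s; rewrite [s \in extra_pairs]inE => /andP[].
apply/subsetP => _ /imsetP[x xX ->]; apply: mem_removed_pairs; first exact: adj_dart.
rewrite adjHE mult_sym mult_out //.
by move: xX; rewrite !inE => /orP[->|/andP[_ ->]]; rewrite ?orbT.
Qed.

Lemma card_cover_extra : #|cover extra_pairs| <= 2 * #|extra_pairs|.
Proof.
apply: leq_trans (leq_card_cover _) _; rewrite mulnC -sum_nat_const; apply: leq_sum => s.
rewrite !inE => /andP[/existsP[x /existsP[y /andP[/eqP -> _]]] _].
by rewrite cards2; case: (x != y).
Qed.

(** * Double edges between two outer vertices *)

Lemma outer_side q : outer q -> adj q u = ~~ adj q w.
Proof.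
case/and3P=> _ _; have := side_vert d; have := side_vert (alpha d); rewrite chirality_alpha => hw hu.
case: (boolP (adj q u)) => [h _|_ /= -> //].
by apply/esym/negP => h'; have := side_adj h; have := side_adj h'; rewrite hu hw; case: (side q); case: chirality.
Qed.

Lemma outer_adj p q : outer p -> outer q -> adj p q -> adj q u = ~~ adj p u.
Proof.
move=> op oq pq; have := outer_side op; have := outer_side oq.
have := side_adj pq; case: (boolP (adj p u)) => [pu|_] sq qE.
  by move=> _; apply/negbTE/negP => qu; have := side_adj pu; rewrite (side_adj qu) sq; case: side.
move/esym/negbFE => pw; rewrite qE; apply/negP => qw.
by have := side_adj pw; rewrite (side_adj qw) sq; case: side.
Qed.

Lemma direct_pair_oriented a b : outer a -> outer b -> mult a b = 2 ->
  exists a b, [/\ outer a, outer b, adj a u & mult a b = 2].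
Proof.
move=> oa ob mab; case au: (adj a u); first by exists a, b.
have [_ _ ab _] := partner_out mab.
by exists b, a; split; rewrite 1?mult_sym // (outer_adj oa ob ab) au.
Qed.

Lemma direct_pair a b : outer a -> outer b -> adj a u -> adj a b ->
  adj b w /\ exists t, [/\ len (side_face t d) = 4, vert (alpha (step t d)) = b &
    exists2 e, vert e = a & step t e = d].
Proof.
move=> oa ob au ab; have bw : adj b w.
  have := outer_side ob; case: (adj b w) => //= bu.
  by have := side_adj au; rewrite (side_adj bu) (side_adj ab); case: side.
split=> //; apply: four_cycle => //; rewrite 1?adj_sym //.
case/and3P: oa => nau naw _; case/and3P: ob => nbu nbw _.
rewrite /= !inE !negb_or eq_sym vert_alpha ![_ == b]eq_sym ![_ == a]eq_sym nau naw nbu nbw /= andbT.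
by apply: contraTneq ab => ->; rewrite adj_irr.
Qed.

(** Each pair closes a square on one side of [d]. Only one face at a vertex has length 4, so both
    squares lie on the same side and coincide. *)
Lemma direct_pair_unique a b a' b' : k <> Honeycomb ->
  outer a -> outer b -> adj a u -> adj a b ->
  outer a' -> outer b' -> adj a' u -> adj a' b' -> a = a' /\ b = b'.
Proof.
move=> nk oa ob au ab oa' ob' au' ab'.
have [_ [t [l4 tb [e <- te]]]] := direct_pair oa ob au ab.
have [_ [t' [l4' tb' [e' <- te']]]] := direct_pair oa' ob' au' ab'.
case: (t =P t') => [tt'|ntt'].
  split; last by rewrite -tb -tb' tt'.
  by congr vert; apply: (@step_inj t); rewrite te tt' te'.
have [l1 l2] : len d = 4 /\ len (alpha d) = 4.
  by case: t t' l4 l4' ntt' {tb tb' te te'} => [] [].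
have /permP/(_ (pred1 4)) /= := kind_perm d; rewrite len_sigma l1 l2 eqxx.
by case: (k) nk => //= _; lia.
Qed.

(** The four outer vertices have four distinct partners, each in an extra pair, and a pair covers at
    most two of them. *)
Lemma extra_pairs_no_direct :
  (forall a b, outer a -> outer b -> mult a b = 2 -> False) -> 1 < #|extra_pairs|.
Proof.
move=> no; have := neighbours_uniq; have := outer_neighbours; rewrite /neighbours.
move: (vert (alpha (sigma d))) (vert (alpha (sigma (sigma d)))) (vert (alpha (sigma (alpha d))))
  (vert (alpha (sigma (sigma (alpha d))))) => a1 a2 a3 a4 on.
have o i : i \in [:: a1; a2; a3; a4] -> exists2 x, mult i x = 2 & x \in cover extra_pairs.
  move=> /on oi; have [x mx] := partner oi; exists x => //.
  have [|s sE xs] := extra_pair mx; first by apply/negP => ox; apply: (no i x).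
  by apply/bigcupP; exists s.
have [x1 m1 c1] := o a1 (mem_head _ _).
have [|x2 m2 c2] := o a2; first by rewrite !inE eqxx orbT.
have [|x3 m3 c3] := o a3; first by rewrite !inE eqxx !orbT.
have [|x4 m4 c4] := o a4; first by rewrite !inE eqxx !orbT.
rewrite /= !inE !negb_or -!andbA => /and5P[n12 n13 n14 n23 /and3P[n24 n34 _]].
have xu : uniq [:: x1; x2; x3; x4].
  by rewrite /= !inE !negb_or (partner_neq n12) // (partner_neq n13) // (partner_neq n14) //
    (partner_neq n23) // (partner_neq n24) // (partner_neq n34).
have : 4 <= #|cover extra_pairs|.
  rewrite -[4]/(size [:: x1; x2; x3; x4]) -(card_uniqP xu); apply: subset_leq_card; apply/subsetP => x.
  by rewrite !inE => /or4P[] /eqP ->.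
by move/leq_trans/(_ card_cover_extra); rewrite (leq_pmul2l (m := 2) (n1 := 2)).
Qed.

(** Without extra pairs every partner is outer, so the two remaining neighbours of [u] would give
    two different direct pairs. *)
Lemma extra_pairs_gt0 : k <> Honeycomb -> 0 < #|extra_pairs|.
Proof.
move=> nk; rewrite lt0n; apply/negP; rewrite cards_eq0 => /eqP E0.
have o i : outer i -> exists2 x, mult i x = 2 & outer x.
  move=> oi; have [x mx] := partner oi; exists x => //.
  by apply: contraT => /(extra_pair mx)[s]; rewrite E0 inE.
have oa1 : outer (vert (alpha (sigma d))) by apply: outer_neighbours; rewrite mem_head.
have oa2 : outer (vert (alpha (sigma (sigma d)))).
  by apply: outer_neighbours; rewrite !inE eqxx orbT.
have [x1 m1 o1] := o _ oa1; have [x2 m2 o2] := o _ oa2.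
have [_ _ ax1 _] := partner_out m1; have [_ _ ax2 _] := partner_out m2.
have au1 : adj (vert (alpha (sigma d))) u by rewrite adj_sym -(vert_sigma d) adj_dart.
have au2 : adj (vert (alpha (sigma (sigma d)))) u.
  by rewrite adj_sym -(vert_sigma d) -(vert_sigma (sigma d)) adj_dart.
have [E _] := direct_pair_unique nk oa1 o1 au1 ax1 oa2 o2 au2 ax2.
by have [_ _] := star_neq d; rewrite E eqxx.
Qed.

Lemma other_neighbour x v : adj (vert x) v -> v != vert (alpha x) ->
  exists v', [/\ adj (vert x) v', v' != vert (alpha x) & v' != v].
Proof.
have [n1 n2 n3] := star_neq x.
have a1 : adj (vert x) (vert (alpha (sigma x))) by rewrite -(vert_sigma x) adj_dart.
have a2 : adj (vert x) (vert (alpha (sigma (sigma x)))).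
  by rewrite -(vert_sigma x) -(vert_sigma (sigma x)) adj_dart.
move/adj_star; rewrite !inE => /or3P[] /eqP -> nv; first by rewrite eqxx in nv.
  by exists (vert (alpha (sigma (sigma x)))).
by exists (vert (alpha (sigma x))); split=> //; rewrite eq_sym.
Qed.

(** With at most one extra pair, some direct pair [a], [b] exists. The other neighbours [a'], [b']
    have non-outer partners [x], [y], which must share the extra pair and so be adjacent; this
    closes a forbidden 6-cycle. *)
Lemma extra_pairs_488 : k = L488 -> 1 < #|extra_pairs|.
Proof.
move=> k488; have nk : k <> Honeycomb by rewrite k488.
rewrite ltnNge; apply/negP => E1.
have [a [b [oa ob au mab]]] : exists a b, [/\ outer a, outer b, adj a u & mult a b = 2].
  case: (boolP [exists a, exists b, [&& outer a, outer b & mult a b == 2]]); last first.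
    move=> no; suff : 1 < #|extra_pairs| by rewrite ltnNge E1.
    apply: extra_pairs_no_direct => a b oa ob mab; case/existsP: no; exists a.
    by apply/existsP; exists b; rewrite oa ob mab.
  case/existsP=> a /existsP[b /and3P[oa ob /eqP mab]].
  exact: (direct_pair_oriented oa ob mab).
have [_ _ ab ba] := partner_out mab; have [bw _] := direct_pair oa ob au ab.
have [nau naw _] := and3P oa; have [nbu nbw _] := and3P ob.
have [|//|a' [ua' na'w na'a]] := @other_neighbour d a; first by rewrite adj_sym.
have [||b' [wb' nb'u nb'b]] := @other_neighbour (alpha d) b; rewrite ?alphaK //; first by rewrite adj_sym.
rewrite alphaK in nb'u.
have oa' : outer a'.
  by rewrite /outer na'w adj_sym ua' andbT; apply: contraTneq ua' => ->; rewrite adj_irr.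
have ob' : outer b'.
  by rewrite /outer nb'u [adj b' w]adj_sym wb' orbT andbT; apply: contraTneq wb' => ->; rewrite adj_irr.
have [x mx] := partner oa'; have [y my] := partner ob'.
have [xu xw a'x xa'] := partner_out mx; have [yu yw b'y yb'] := partner_out my.
have nx : ~~ outer x.
  apply/negP => ox; have a'u : adj a' u by rewrite adj_sym.
  by have [E _] := direct_pair_unique nk oa ob au ab oa' ox a'u a'x; rewrite E eqxx in na'a.
have ny : ~~ outer y.
  apply/negP => oy; have yu' : adj y u.
    by rewrite (outer_adj ob' oy b'y) (outer_side ob') adj_sym wb'.
  by have [_ E] := direct_pair_unique nk oa ob au ab oy ob' yu' yb'; rewrite E eqxx in nb'b.
have a'b' : a' != b'.
  by apply: contraTneq ua' => E; rewrite adj_sym (outer_side oa') E [adj b' w]adj_sym wb'.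
have xy := partner_neq a'b' mx my.
have yx : adj y x.
  have [s sE xs] := extra_pair mx nx; have [s' sE' ys] := extra_pair my ny.
  have ss' : s = s' by apply: (card_le1_eqP E1).
  move: sE' ys xs; rewrite ss' 2!inE => /andP[/existsP[p /existsP[q /and3P[/eqP -> pq _]]] _].
  rewrite !inE => /orP[] /eqP yE /orP[] /eqP xE; rewrite yE xE ?eqxx // in xy *.
  by rewrite adj_sym.
have neq_out p q : outer p -> ~~ outer q -> p != q.
  by move=> op; apply: contraNneq => <-.
apply: (@no_six_cycle d a b a' b' x y k488) => //; rewrite 1?adj_sym //.
- rewrite /= !inE !negb_or eq_sym vert_alpha ![_ == b]eq_sym ![_ == a]eq_sym nau naw nbu nbw /= andbT.
  by apply: contraTneq ab => ->; rewrite adj_irr.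
have [na'u _ _] := and3P oa'; have [_ nb'w _] := and3P ob'.
rewrite /= !inE !negb_or eq_sym vert_alpha ![u == _]eq_sym ![w == _]eq_sym.
rewrite xu xw yu yw na'u na'w nb'u nb'w ![y == _]eq_sym ![x == a']eq_sym ![b' == a']eq_sym a'b' xy.
by rewrite !neq_out.
Qed.

Lemma extra_pairs_card : expected_L k <= 5 + #|extra_pairs|.
Proof.
case kE: (k).
- rewrite (leq_add2l 5 2); apply: extra_pairs_no_direct => a b oa ob mab.
  have [a' [b' [oa' ob' au mab']]] := direct_pair_oriented oa ob mab.
  have [_ _ ab _] := partner_out mab'; have [_ [t [l4 _ _]]] := direct_pair oa' ob' au ab.
  by have := len_mem (side_face t d); rewrite kE l4.
- by rewrite (leq_add2l 5 2) extra_pairs_488.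
by rewrite (leq_add2l 5 1) extra_pairs_gt0 // kE.
Qed.

End Competitor.
End ShortCycles.
End Lattice.

Theorem theorem2 (k : lattice_kind) (V D : finType) (alpha sigma : D -> D)
  (vert : D -> V) (col : D -> 'I_3) :
  colour_code_lattice alpha sigma vert col ->
  kind_ok k alpha sigma ->
  (forall p : seq D, graph_cycle alpha vert p ->
     ~ contractible alpha sigma p -> 8 < size p) ->
  forall d0 : D, defect_ok k alpha sigma d0 ->
  (* G' uses only connections of G *)
  (forall f, f \in edges' alpha sigma vert col d0 ->
     exists x y, ends vert f = [set x; y] /\ map_adj alpha vert x y) /\
  (* the value of L(G') *)
  removed_connections (map_adj alpha vert) (adj' alpha sigma vert col d0)
    = expected_L k /\
  (* optimality among all admissible H *)
  (forall (DH : finType) (aH sH : DH -> DH) (vH : DH -> V) (w' : V),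
     map_adj alpha vert (vert d0) w' ->
     is_torus_map aH sH vH ->
     trivalent sH ->
     three_face_colourable aH sH ->
     map_vertices vH = map_vertices vert :\ vert d0 :\ w' ->
     (forall d, map_adj alpha vert (vH d) (vH (aH d))) ->
     removed_connections (map_adj alpha vert) (adj' alpha sigma vert col d0)
       <= removed_connections (map_adj alpha vert) (map_adj aH vH)).
Proof.
move=> lat kind short d0 defect.
have valE : removed_connections (map_adj alpha vert) (adj' alpha sigma vert col d0) = expected_L k.
  have := removed_connections_super_plaquette lat kind d0.
  (* The shrink face lengths add up to 6 + 6, 4 + 8 and 4 + 6 respectively. *)
  suff -> : order (phi alpha sigma) d0 + order (phi alpha sigma) (alpha d0) = 2 * (expected_L k).-1.
    by case: (k) => /=; lia.
  case: k kind defect {short} => /= [kind _|_ /perm_sumn|_ /perm_sumn] /=; try lia.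
  by rewrite !kind.
split; [|split=> // DH aH sH vH w' uw' torusH triH _ vertsH adjH].
  move=> f /kept_edge_dart[z [b ->]]; exists (vert z), (vert (alpha z)).
  by rewrite ends_edg adj_dart.
(* The lower bound is applied to the edge towards [w'], whichever neighbour this is. *)
case/existsP: uw' => d /andP[/eqP du /eqP dw].
rewrite -du -dw in vertsH; rewrite valE.
apply: leq_trans (removed_pairs_card lat kind torusH vertsH adjH).
exact: (extra_pairs_card lat kind short torusH triH vertsH adjH).
Qed.
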